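(* Let $G$ be a second countable locally compact unimodular group such that the left regular representation $\lambda_G$ of $G$ on $\mathrm{L}^2(G)$ has an admissible vector. Then $G$ is discrete.
   Context: $\mathrm{L}^2(G)$ is taken with respect to a (left) Haar measure $\mu_G$; $\lambda_G$ is the left regular representation, $(\lambda_G(x)f)(y)=f(x^{-1}y)$. A vector $g\in\mathrm{L}^2(G)$ is admissible for $\lambda_G$ if the map $f\mapsto V_gf$, $V_gf(x)=\langle f,\lambda_G(x)g\rangle$ ($x\in G$), is an isometry of $\mathrm{L}^2(G)$ into $\mathrm{L}^2(G)$. *)

(* Defs.v *)
From HB Require Import structures.
From mathcomp Require Import all_boot all_order all_algebra.
From mathcomp Require Import all_classical all_reals all_analysis.
From mathcomp Require Import complex.

Set Implicit Arguments.
Unset Strict Implicit.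
Unset Printing Implicit Defensive.

Import Order.TTheory GRing.Theory Num.Theory.
Import numFieldNormedType.Exports.

Local Open Scope classical_set_scope.
Local Open Scope ring_scope.

HB.mixin Record isTopologicalGroup G & Topological G & Group G := {
  mulg_continuous : continuous (fun p : G * G => (p.1 * p.2)%g) ;
  invg_continuous : continuous (fun x : G => x^-1%g)
}.

#[short(type="topologicalGroupType")]
HB.structure Definition TopologicalGroup :=
  {G of Topological G & Group G & isTopologicalGroup G}.

(* G with its Borel sigma-algebra. This is an alias because measurable types
   are pointed; the base point is the neutral element. *)
Definition borel (G : topologicalGroupType) : Type := G.

Section borel_instances.
Variable G : topologicalGroupType.

HB.instance Definition _ := Choice.on (borel G).
HB.instance Definition _ := isPointed.Build (borel G) (1%g : G).
HB.instance Definition _ := Measurable.copy (borel G)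
  (g_sigma_algebraType (@open G : set (set (borel G)))).

End borel_instances.

Section haar.
Context (R : realType) (G : topologicalGroupType).
Implicit Type mu : {measure set (borel G) -> \bar R}.

Definition left_invariant mu := forall (x : G) (A : set (borel G)),
  measurable A -> mu [set (x * y)%g | y in A] = mu A.

Definition right_invariant mu := forall (x : G) (A : set (borel G)),
  measurable A -> mu [set (y * x)%g | y in A] = mu A.

Definition radon mu :=
  [/\ forall K : set G, compact K -> (mu K < +oo)%E,
      forall A : set (borel G), measurable A ->
        mu A =
        ereal_inf [set mu U | U in [set U : set G | open U /\ A `<=` U]]
    & forall U : set G, open U ->
        mu U =
        ereal_sup [set mu K | K in [set K : set G | compact K /\ K `<=` U]]].

Definition left_haar mu :=
  [/\ radon mu, mu [set: borel G] != 0%E & left_invariant mu].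

End haar.

(* By uniqueness of Haar measure up to scaling, this says that the modular
   function of G is constantly 1. *)
Definition unimodular (R : realType) (G : topologicalGroupType) :=
  forall mu : {measure set (borel G) -> \bar R},
    left_haar mu -> right_invariant mu.

Section square_integrable.
Context (R : realType) (G : topologicalGroupType).
Variable mu : {measure set (borel G) -> \bar R}.
Implicit Types f g : G -> R[i].

(* The elements of L^2(G) are represented by square-integrable functions; all
   the notions below depend only on their classes modulo equality mu-a.e. *)
Definition L2norm f : \bar R :=
  Lnorm mu 2%:E (fun x => (Normc.normc (f x))%:E).

Definition L2 : set (G -> R[i]) := [set f |
  [/\ measurable_fun [set: borel G] (fun x => complex.Re (f x)),
      measurable_fun [set: borel G] (fun x => complex.Im (f x))
    & (L2norm f < +oo)%E]].

Definition cintegral f : R[i] :=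
  Complex (\int[mu]_(x in [set: borel G]) complex.Re (f x))
          (\int[mu]_(x in [set: borel G]) complex.Im (f x)).

Definition L2inner f g : R[i] := cintegral (fun y => f y * conjc (g y)).

Definition left_regular (x : G) f : G -> R[i] := fun y => f (x^-1 * y)%g.

(* V_g f (x) = < f, lambda_G(x) g >, the inner product being linear in its
   first argument. *)
Definition voice g f : G -> R[i] := fun x => L2inner f (left_regular x g).

(* V_g is linear, so it is an isometry iff it preserves the L^2-norm. *)
Definition admissible g :=
  L2 g /\ forall f, L2 f -> L2 (voice g f) /\ L2norm (voice g f) = L2norm f.

End square_integrable.

(* Main.v *)
(* Let g be admissible and let U be a Borel set of finite measure. By
   Cauchy-Schwarz, |V_g 1_U (x)|^2 <= mu U * \int_U |g (x^-1 y)|^2 dy. Integrating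
   over x with Tonelli's theorem, left invariance (to substitute x y for y) and
   right invariance (so that the set of x with x y in U has measure mu U) gives
   mu U = ||V_g 1_U||^2 <= (mu U)^2 ||g||^2, hence mu U >= 1 / ||g||^2 as soon as
   mu U > 0. Nonempty open sets have positive measure, so by outer regularity
   mu {1} > 0, and an open neighbourhood of 1 of measure less than 2 mu {1}
   contains no other point. *)
From HB Require Import structures.
Require Import Defs.
From mathcomp Require Import all_boot all_order all_algebra.
From mathcomp Require Import all_classical all_reals all_analysis.
From mathcomp Require Import complex measurable_realfun.
From mathcomp Require Import lra.

Set Implicit Arguments.
Unset Strict Implicit.
Unset Printing Implicit Defensive.

Import Order.TTheory GRing.Theory Num.Theory.
Import numFieldNormedType.Exports.
Local Open Scope classical_set_scope.
Local Open Scope ring_scope.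

(** * Countable bases and countable covers *)

Lemma second_countable_seq (T : topologicalType) : @second_countable T ->
  exists2 b : nat -> set T, (forall n, open (b n)) &
    forall (U : set T) x, open U -> U x -> exists2 n, b n x & b n `<=` U.
Proof.
move=> [B /countable_injP[f finj] [Bo Bb]].
(* By injectivity of [f] on [B], at most one basic set has code [n]; this union is that set, or
   empty if there is none. *)
exists (fun n => \bigcup_(U in [set U | B U /\ f U = n]) U) => [n|U x oU Ux].
  by apply: bigcup_open => U [/Bo].
have [V [BV Vx] VU] := Bb x U (open_nbhs_nbhs (conj oU Ux)).
exists (f V); first by exists V.
by move=> y [W [BW fWV] Wy]; apply: VU; rewrite -(finj W V) ?inE.
Qed.

(** Discard the basic sets that fail [P]. Those left still cover, because [P] passes to the basic
    set squeezed between a point and its [P]-neighbourhood. *)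
Lemma lindelof (T : topologicalType) (P : set (set T)) : @second_countable T ->
  (forall A B, A `<=` B -> P B -> P A) -> P set0 ->
  (forall x, exists U, [/\ open U, U x & P U]) ->
  exists F : nat -> set T, (forall n, open (F n) /\ P (F n)) /\
    \bigcup_n F n = setT.
Proof.
move=> /second_countable_seq[b bo bb] PS P0 PT.
exists (fun n => if `[< P (b n) >] then b n else set0); split.
  by move=> n; case: asboolP => // _; split=> //; exact: open0.
apply/seteqP; split=> // x _; have [U [oU Ux PU]] := PT x.
have [n bnx bnU] := bb U x oU Ux.
by exists n => //; rewrite asboolT//; exact: PS PU.
Qed.

(** * Tonelli and Cauchy-Schwarz *)

Lemma sigma_finite_tonelli d (T : measurableType d) (R : realType)
    (mu : {measure set T -> \bar R}) (f : T * T -> \bar R) :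
  sigma_finite setT mu -> measurable_fun setT f -> (forall z, 0 <= f z)%E ->
  (measurable_fun setT (fun x => \int[mu]_y f (x, y)) /\
   \int[mu]_x \int[mu]_y f (x, y) = \int[mu]_y \int[mu]_x f (x, y))%E.
Proof.
case: mu => m cm sf mf f0.
pose H1 := isSFinite.Build _ _ _ m
  (@sfinite_measure_sigma_finite _ _ _ (Measure.Pack cm) sf).
pose H2 := isSigmaFinite.Build _ _ _ m sf.
(* The same set function, repacked so that its type carries the hypothesis of sigma-finiteness. *)
pose mu' := HB.pack_for (SigmaFiniteMeasure.type T R) m cm H1 H2.
have -> : Measure.Pack cm = mu' by exact: eq_measure.
split; last exact: fubini_tonelli.
exact: measurable_fun_fubini_tonelli_F.
Qed.

(** Hölder with both exponents 2, applied to [\1_U] and [\1_U * a], whose product is again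
    [\1_U * a]. *)
Lemma sqr_Rintegral_indic_le d (T : measurableType d) (R : realType)
    (mu : {measure set T -> \bar R}) (U : set T) (a : T -> R) :
  measurable U -> measurable_fun setT a ->
  (((\int[mu]_x (\1_U x * a x)) ^+ 2)%:E <=
    mu U * \int[mu]_x (\1_U x * a x ^+ 2)%:E)%E.
Proof.
move=> mU ma.
have m1 : measurable_fun setT (\1_U : T -> R) by exact: measurable_indic.
have m2 : measurable_fun setT (fun x => \1_U x * a x) by exact: measurable_funM.
set I := (\int[mu]_x _)%R.
have hI : (`|I|%:E <= 'N[mu]_2%:E[EFin \o \1_U] *
    'N[mu]_2%:E[EFin \o (fun x => \1_U x * a x)%R])%E.
  apply: (@le_trans _ _ ('N[mu]_1[EFin \o (\1_U \* (fun x => \1_U x * a x))%R])%E);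
    last by apply: hoelder => //; lra.
  rewrite Lnorm1.
  have -> : (\int[mu]_x `|(EFin \o (\1_U \* (fun x => \1_U x * a x))%R) x| =
      \int[mu]_x `|(\1_U x * a x)%R%:E|)%E.
    apply: eq_integral => x _ /=; rewrite mulrA indicE.
    by case: (x \in U); rewrite ?mulr1 ?mulr0.
  apply: le_trans (le_abse_integral _ _ _) => //; last exact/measurable_EFinP.
  (* If the extended integral is infinite, the real-valued one is 0 by convention and the bound is
     trivial. *)
  by rewrite /I /Rintegral; case: (integral _ _ _) => //=; rewrite normr0 leey.
have Lsq (f : T -> R) :
    ('N[mu]_2%:E[EFin \o f] `^ 2 = \int[mu]_x (f x ^+ 2)%:E)%E.
  rewrite poweR_Lnorm//; apply: eq_integral => x _ /=.
  by rewrite powR_mulrn// -normrX ger0_norm// sqr_ge0.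
have -> : ((I ^+ 2)%:E = `|I|%:E `^ 2)%E.
  by rewrite poweR_EFin powR_mulrn// -normrX ger0_norm// sqr_ge0.
apply: (@le_trans _ _ (('N[mu]_2%:E[EFin \o \1_U] *
    'N[mu]_2%:E[EFin \o (fun x => \1_U x * a x)%R]) `^ 2)%E).
  apply: gt0_ler_poweR => //; rewrite in_itv/= ?leey ?andbT ?lee_fin//.
  by rewrite mule_ge0// Lnorm_ge0.
rewrite poweRM ?Lnorm_ge0// !Lsq le_eqVlt; apply/orP; left; apply/eqP.
congr (_ * _)%E.
  rewrite -[in RHS](setIT U) -integral_indic//; apply: eq_integral => x _.
  by rewrite indicE; case: (x \in U); rewrite ?expr1n ?expr0n.
apply: eq_integral => x _.
by rewrite exprMn indicE; case: (x \in U); rewrite ?expr1n ?expr0n.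
Qed.

(** * Translations and the Borel sigma-algebra *)

Section topological_group.
Context {G : topologicalGroupType}.

Lemma lmul_preimage (x : G) (A : set G) :
  [set (x * y)%g | y in A] = (fun y => x^-1 * y)%g @^-1` A.
Proof.
apply/seteqP; split=> [_ [y Ay <-]|y Ay] /=; first by rewrite mulKg.
by exists (x^-1 * y)%g => //; rewrite mulVKg.
Qed.

Lemma rmul_preimage (x : G) (A : set G) :
  [set (y * x)%g | y in A] = (fun y => y * x^-1)%g @^-1` A.
Proof.
apply/seteqP; split=> [_ [y Ay <-]|y Ay] /=; first by rewrite mulgK.
by exists (y * x^-1)%g => //; rewrite mulgVK.
Qed.

Lemma lmul_continuous (x : G) : continuous (fun y : G => x * y)%g.
Proof.
move=> y; apply: (@continuous_comp _ _ _ (fun y => (x, y)) (fun p => p.1 * p.2)%g).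
  by apply: cvg_pair => //=; exact: cvg_cst.
exact: mulg_continuous.
Qed.

Lemma rmul_continuous (x : G) : continuous (fun y : G => y * x)%g.
Proof.
move=> y; apply: (@continuous_comp _ _ _ (fun y => (y, x)) (fun p => p.1 * p.2)%g).
  by apply: cvg_pair => //=; exact: cvg_cst.
exact: mulg_continuous.
Qed.

Lemma open_borel (U : set G) : open U -> measurable (U : set (borel G)).
Proof. by move=> oU; apply: sub_sigma_algebra. Qed.

Lemma closed_borel (U : set G) : closed U -> measurable (U : set (borel G)).
Proof.
move=> cU; rewrite -(setCK U); apply: measurableC; apply: open_borel.
exact: closed_openC.
Qed.

Lemma continuous_borel (f : G -> G) : continuous f ->
  measurable_fun setT (f : borel G -> borel G).
Proof.
move=> /continuousP cf; apply: (@measurability _ _ _ (borel G) _ _ (@open G : set (set (borel G)))) => //.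
by move=> _ [U oU <-]; rewrite setTI; apply: open_borel; exact: cf.
Qed.

Lemma measurable_mulg : @second_countable G ->
  measurable_fun setT
    (fun p : borel G * borel G => (p.1 : G) * (p.2 : G) : borel G)%g.
Proof.
move=> /second_countable_seq[b bo bb]; apply: (@measurability _ _ _ (borel G) _ _ (@open G : set (set (borel G)))) => //.
move=> _ [U oU <-]; rewrite setTI.
have mo : open ((fun p : G * G => p.1 * p.2)%g @^-1` U).
  by move/continuousP : (@mulg_continuous G); exact.
(* An open set of G * G is a countable union of products of basic open sets,
   so it lies in the product of the Borel sigma-algebras. *)
pose F (p : nat * nat) : set (borel G * borel G) :=
  if `[< b p.1 `*` b p.2 `<=` (fun p : G * G => p.1 * p.2)%g @^-1` U >]
  then b p.1 `*` b p.2 else set0.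
rewrite [X in measurable X](_ : _ = \bigcup_p F p); last first.
  apply/seteqP; split=> [[x y] /= Uxy|[x y] [p _]]; last first.
    by rewrite /F; case: asboolP => // + xy; exact.
  have /= [[V W] [/= Vx Wy] VW] := (open_nbhs_nbhs (conj mo (Uxy : _ (x, y)))).
  move: Vx Wy; rewrite !nbhsE => -[V' [oV' V'x] VV'] [W' [oW' W'y] WW'].
  have [n bnx bnV] := bb _ _ oV' V'x; have [m bmy bmW] := bb _ _ oW' W'y.
  exists (n, m) => //; rewrite /F asboolT//=.
  by move=> [u v] [/= /bnV/VV' Vu /bmW/WW' Wv]; exact: (VW (u, v)).
apply: countable_bigcupT_measurable => [|p]; first exact: countableP.
rewrite /F; case: asboolP => // _.
by apply: measurableX; exact: open_borel.
Qed.

End topological_group.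

(** * Haar measure and the lower bound on measures of sets *)

Section haar_measure.
Context {R : realType} {G : topologicalGroupType}.
Variable mu : {measure set (borel G) -> \bar R}.

(** Countably many open sets lying in closed compact sets cover [G]. Compactness of [K] makes [mu K]
    finite, and closedness makes [K] Borel, as monotonicity requires. *)
Lemma haar_sigma_finite : locally_compact [set: G] -> @second_countable G ->
  left_haar mu -> sigma_finite setT mu.
Proof.
move=> lcG scG [[muK _ _] _ _].
have [||x|F [oF FT]] := @lindelof G
    [set U | exists2 K, compact K & closed K /\ U `<=` K] scG.
- by move=> A B AB [K cK [clK BK]]; exists K => //; split=> //; exact: subset_trans BK.
- by exists set0; [exact: compact0|split=> //; exact: closed0].
- have [] := lcG x I.
  move=> K xK [cK clK]; have {}xK : nbhs x K
    by apply: (@filterS _ (nbhs x) _ _ _ _ xK) => y; exact.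
  exists K°; split; [exact: open_interior|by []|].
  by exists K => //; split=> //; exact: interior_subset.
exists F => // n; have [oFn [K cK [clK FK]]] := oF n; split; first exact: open_borel.
apply: le_lt_trans (muK _ cK).
by apply: le_measure => //; rewrite inE; [exact: open_borel|exact: closed_borel].
Qed.

(** If [U] were null, so would be its left translates; countably many open subsets of these cover
    [G], which would then be null. *)
Lemma haar_open_gt0 (U : set G) : @second_countable G -> left_haar mu ->
  open U -> U !=set0 -> (0 < mu U)%E.
Proof.
move=> scG [_ muT linv] oU [u Uu]; rewrite lt0e measure_ge0 andbT.
apply/negP => /eqP U0.
have muxU x : mu [set (x * y)%g | y in U] = 0%E.
  by rewrite linv//; exact: open_borel.
have oxU x : open [set (x * y)%g | y in U].
  by rewrite lmul_preimage; move/continuousP : (@lmul_continuous G x^-1%g); exact.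
have [||x|F [oF FT]] := @lindelof G
    [set A | exists x, A `<=` [set (x * y)%g | y in U]] scG.
- by move=> A B AB [x Bx]; exists x; exact: subset_trans Bx.
- by exists 1%g.
(* This translation carries [u] to [x]. *)
- exists [set (x * u^-1 * y)%g | y in U]; split=> //.
    by exists u => //; rewrite mulgVK.
  by exists (x * u^-1)%g.
move/negP : muT; apply; rewrite -measure_le0.
have mF n : measurable (F n : set (borel G)) by apply: open_borel; have [] := oF n.
have FT' : [set: borel G] `<=` \bigcup_n F n by rewrite -FT.
apply: le_trans (measure_sigma_subadditive mu mF measurableT FT') _.
rewrite eseries0// => n _ _; apply/eqP; rewrite -measure_le0.
have [_ [x Fx]] := oF n; rewrite -(muxU x).
by apply: le_measure => //; rewrite inE//; exact: open_borel.
Qed.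

Lemma left_invariant_integral (x : G) (f : borel G -> \bar R) :
  left_invariant mu -> measurable_fun setT f -> (forall y, 0 <= f y)%E ->
  (\int[mu]_y f (x * y)%g = \int[mu]_y f y)%E.
Proof.
move=> linv mf f0.
have mx : measurable_fun setT ((fun y => x * y)%g : borel G -> borel G).
  by apply: continuous_borel; exact: lmul_continuous.
transitivity (\int[pushforward mu ((fun y => x * y)%g : borel G -> borel G)]_y f y)%E.
  by rewrite (ge0_integral_pushforward mx)// => y _; exact: f0.
apply: eq_measure_integral => A mA _.
by rewrite -[RHS](linv x^-1%g)// lmul_preimage invgK.
Qed.

Lemma L2norm_sqr (f : G -> R[i]) : (L2norm mu f `^ 2 =
  \int[mu]_x (complex.Re (f x) ^+ 2 + complex.Im (f x) ^+ 2)%:E)%E.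
Proof.
rewrite /L2norm poweR_Lnorm//; apply: eq_integral => x _.
case: (f x) => a b /=.
rewrite powR_mulrn// -normrX sqr_sqrtr ?addr_ge0 ?sqr_ge0//.
by rewrite ger0_norm ?addr_ge0 ?sqr_ge0.
Qed.

(** After the exchange, the integral over [x] for fixed [y] is the measure of the translate of [U]
    by [y^-1] on the right. This is where right invariance enters. *)
Lemma haar_tonelli (U : set (borel G)) (h : borel G -> \bar R) :
  @second_countable G -> sigma_finite setT mu -> right_invariant mu ->
  measurable U -> measurable_fun setT h -> (forall y, 0 <= h y)%E ->
  (measurable_fun setT (fun x : borel G => \int[mu]_y ((\1_U ((x : G) * (y : G))%g)%:E * h y)) /\
   \int[mu]_x \int[mu]_y ((\1_U ((x : G) * (y : G))%g)%:E * h y) =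
   mu U * \int[mu]_y h y)%E.
Proof.
move=> scG sf rinv mU mh h0.
pose f (p : borel G * borel G) : \bar R :=
  ((\1_U ((p.1 : G) * (p.2 : G))%g)%:E * h p.2)%E.
have mf : measurable_fun setT f.
  apply: emeasurable_funM; last by apply: measurableT_comp.
  apply/measurable_EFinP.
  apply: (measurableT_comp (measurable_indic mU)); exact: measurable_mulg.
have f0 p : (0 <= f p)%E by rewrite mule_ge0.
have [mF ->] := sigma_finite_tonelli sf mf f0; split=> //.
rewrite -ge0_integralZl//; apply: eq_integral => y _ /=.
rewrite /f/=; under eq_integral do rewrite muleC.
rewrite ge0_integralZl//; last first.
  apply/measurable_EFinP; apply: (measurableT_comp (measurable_indic mU)).
  by apply: continuous_borel; exact: rmul_continuous.
rewrite muleC; congr (_ * _)%E.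
rewrite -(rinv y^-1%g U mU) rmul_preimage invgK.
rewrite -[in RHS](setIT (_ @^-1` _)) -integral_indic//.
rewrite -[_ @^-1` _]setTI.
have := continuous_borel (@rmul_continuous G y).
by move=> /(_ measurableT U mU).
Qed.

Lemma admissible_measure_ge (g : G -> R[i]) (U : set (borel G)) :
  @second_countable G -> sigma_finite setT mu ->
  left_invariant mu -> right_invariant mu -> admissible mu g ->
  measurable U -> (mu U < +oo)%E ->
  (mu U <= mu U * (mu U * L2norm mu g `^ 2))%E.
Proof.
move=> scG sf linv rinv [[mRg mIg _] adm] mU Uoo.
pose f (y : G) : R[i] := Complex (\1_U y) 0.
have fsq : (L2norm mu f `^ 2 = mu U)%E.
  rewrite L2norm_sqr -[in RHS](setIT U) -integral_indic//.
  apply: eq_integral => x _; rewrite /f/= expr0n addr0 indicE.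
  by case: (_ \in _); rewrite ?expr1n ?expr0n.
have L2f : L2 mu f.
  split => //; first exact: measurable_indic.
  (* An infinite norm would have an infinite square, namely [mu U]. *)
  rewrite ltey; apply/eqP => foo; move: fsq; rewrite foo poweRyr// => E.
  by rewrite -E in Uoo.
have [[mRv mIv _] vf] := adm f L2f.
pose h (y : borel G) : \bar R :=
  (complex.Re (g y) ^+ 2 + complex.Im (g y) ^+ 2)%:E.
have mh : measurable_fun setT h.
  by apply/measurable_EFinP/measurable_funD; exact: measurable_funX.
have h0 y : (0 <= h y)%E by rewrite lee_fin addr_ge0 ?sqr_ge0.
have [mF FE] := haar_tonelli scG sf rinv mU mh h0.
(* Both sides become integrals over [x], so it suffices to compare the integrands for each [x]. *)
rewrite -{1}fsq -vf !L2norm_sqr -/h -FE -ge0_integralZl//; last first.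
  by move=> x _; apply: integral_ge0 => y _; rewrite mule_ge0.
apply: ge0_le_integral => //.
- by move=> x _; rewrite lee_fin addr_ge0 ?sqr_ge0.
- by apply/measurable_EFinP/measurable_funD; exact: measurable_funX.
- exact: measurable_funeM.
move=> x _.
have mx : measurable_fun setT ((fun y => x^-1 * y)%g : borel G -> borel G).
  by apply: continuous_borel; exact: lmul_continuous.
have mR : measurable_fun setT ((fun y => complex.Re (g (x^-1 * y)%g)) : borel G -> R).
  exact: measurableT_comp mRg mx.
have mI : measurable_fun setT
    ((fun y => - complex.Im (g (x^-1 * y)%g)) : borel G -> R).
  by apply: measurableT_comp => //; exact: measurableT_comp mIg mx.
have RE : complex.Re (voice mu g f x) =
    \int[mu]_y (\1_U y * complex.Re (g (x^-1 * y)%g)).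
  rewrite /voice /L2inner /cintegral /=; apply: eq_Rintegral => y _.
  by rewrite /f /left_regular; case: (g _) => a b /=; rewrite mul0r subr0.
have IE : complex.Im (voice mu g f x) =
    \int[mu]_y (\1_U y * - complex.Im (g (x^-1 * y)%g)).
  rewrite /voice /L2inner /cintegral /=; apply: eq_Rintegral => y _.
  by rewrite /f /left_regular; case: (g _) => a b /=; rewrite mul0r addr0.
(* Cauchy-Schwarz is applied to the real and imaginary parts separately, and the two bounds add up
   to one in [h]. *)
rewrite RE IE EFinD.
apply: le_trans (leeD (sqr_Rintegral_indic_le mu mU mR)
  (sqr_Rintegral_indic_le mu mU mI)) _.
rewrite -ge0_muleDr; last 2 first.
- by apply: integral_ge0 => y _; rewrite lee_fin mulr_ge0 ?sqr_ge0.
- by apply: integral_ge0 => y _; rewrite lee_fin mulr_ge0 ?sqr_ge0.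
rewrite lee_wpmul2l//.
rewrite -ge0_integralD//; first last.
- by apply/measurable_EFinP/measurable_funM => //; exact: measurable_funX.
- by move=> y _; rewrite lee_fin mulr_ge0 ?sqr_ge0.
- by apply/measurable_EFinP/measurable_funM => //; exact: measurable_funX.
- by move=> y _; rewrite lee_fin mulr_ge0 ?sqr_ge0.
(* Substituting [x * y] for [y] moves the translation from [g] to [\1_U]. *)
rewrite -[leLHS](left_invariant_integral x)//.
- rewrite le_eqVlt; apply/orP; left; apply/eqP; apply: eq_integral => y _.
  by rewrite /h /= mulKg sqrrN -EFinD -mulrDr EFinM.
- by apply: emeasurable_funD; apply/measurable_EFinP/measurable_funM => //;
    exact: measurable_funX.
- by move=> y; rewrite lee_fin addr_ge0// mulr_ge0 ?sqr_ge0.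
Qed.

End haar_measure.

Theorem proposition0p4 (R : realType) (G : topologicalGroupType)
    (hausG : hausdorff_space G) (lcG : locally_compact [set: G])
    (scG : @second_countable G) (uniG : unimodular R G)
    (mu : {measure set (borel G) -> \bar R}) (haar_mu : left_haar mu)
    (adm : exists g : G -> R[i], admissible mu g) :
  forall A : set G, open A.
Proof.
have [[muK outer _] _ linv] := haar_mu.
have [g admg] := adm.
have sf := haar_sigma_finite lcG scG haar_mu.
have mset1 (x : G) : measurable ([set x] : set (borel G)).
  by apply: closed_borel; apply: accessible_closed_set1; exact: hausdorff_accessible.
have mu_set1 (x : G) : mu [set x] = mu [set 1%g : G].
  by rewrite -[RHS](linv x)// image_set1 /= mulg1.
have mu1_fin : mu [set 1%g : G] \is a fin_num.
  by rewrite ge0_fin_numE// muK//; exact: compact_set1.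
have Noo : (L2norm mu g `^ 2 < +oo)%E by apply: poweR_lty; have [[]] := admg.
have Nfin : (L2norm mu g `^ 2)%E \is a fin_num by rewrite ge0_fin_numE// poweR_ge0.
have mu1_gt0 : (0 < mu [set 1%g : G])%E.
  rewrite lt0e measure_ge0 andbT; apply/negP => /eqP mu1.
  have := poweR_ge0 (L2norm mu g) 2; rewrite -(fineK Nfin) lee_fin.
  set n := fine _ => n0.
  (* Here [n] is the squared norm of [g]. The lower bound gives [1 <= mu U * n], against
     [mu U * (n + 1) < 1]; adding 1 keeps the inverse meaningful when [n] is 0. *)
  have /ereal_inf_lt[_ [U [oU U1] <-] Un] :
      (ereal_inf [set mu U | U in [set U : set G | open U /\ [set 1%g] `<=` U]]
        < ((n + 1)^-1)%:E)%E.
    by rewrite -outer// mu1 lte_fin invr_gt0; lra.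
  have Uoo := lt_trans Un (ltry _).
  have := haar_open_gt0 scG haar_mu oU (ex_intro _ 1%g (U1 _ erefl)).
  have := admissible_measure_ge scG sf linv (uniG mu haar_mu) admg
    (open_borel oU) Uoo.
  move: Un; rewrite -(fineK Nfin) -/n.
  have /fineK <- : mu U \is a fin_num by rewrite ge0_fin_numE.
  rewrite -!EFinM !lee_fin !lte_fin => + + u0.
  rewrite -[_^-1]mul1r ltr_pdivlMr; last by lra.
  rewrite -[X in X <= _]mulr1 ler_pM2l//; nra.
have /ereal_inf_lt[_ [U [oU U1] <-] Um] :
    (ereal_inf [set mu U | U in [set U : set G | open U /\ [set 1%g] `<=` U]]
      < mu [set 1%g : G] + mu [set 1%g : G])%E.
  by rewrite -outer// lteDl.
have UE : U = [set 1%g].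
  apply/seteqP; split=> // y Uy; apply: contrapT => /= y1.
  move: Um; rewrite ltNge => /negP; apply.
  (* A second point [y] in [U] would have the same mass as 1, so [U] would have measure at least
     twice that mass. *)
  rewrite -{2}(mu_set1 y) -measureU//.
    apply: le_measure; rewrite ?inE; [exact: measurableU|exact: open_borel|].
    by move=> z [/U1|->].
  by apply/seteqP; split=> // z [-> /esym].
(* [A] is the union of its singletons, each a left translate of the open set [U]. *)
move=> A; rewrite -(image_id A) -bigcup_imset1.
apply: bigcup_open => x _.
have -> : [set x] = [set (x * y)%g | y in U] by rewrite UE image_set1 /= mulg1.
rewrite lmul_preimage; move/continuousP : (@lmul_continuous G x^-1%g); exact.
Qed.
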